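(* Let $G\in\mathbb F_4^{m\times n}$ be a full-rank matrix with entries $g_{a,i}$ and let $1\le k\le m$. Let $D_G$ be the diagonal unitary on $m$ $\mathbb F_4$-qudits ($2m$ qubits) induced by applying a $CS$ gate to each of the $n$ pairs of physical qubits, as defined in the context. Then: (1) There exist a diagonal Clifford unitary $C$ on the $2m$ qubits and a diagonal unitary $V$ on the first $k$ qudits with $D_G=C\,(V\otimes I)$ if and only if $$\sum_{i=1}^n g_{a,i}\,g_{b,i}\,g_{c,i}=0\quad\text{for all } a,b,c\in\{1,\dots,m\}\text{ not all in }\{1,\dots,k\}.$$ (2) There exists a diagonal Clifford unitary $C$ on the $2m$ qubits with $D_G=C\,(CS^{\otimes k}\otimes I)$, where $CS^{\otimes k}$ applies one $CS$ gate to the two qubits of each of the first $k$ qudits, if and only if $$\sum_{i=1}^n g_{a,i}\,g_{b,i}\,g_{c,i}=\begin{cases}1 & \text{if }1\le a=b=c\le k,\\ 0&\text{otherwise.}\end{cases}$$ Here all sums over $i$ are taken in $\mathbb F_4$.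
   Context: $\mathbb F_4=\{0,1,\omega,\omega^2\}$ with $\omega^2=\omega+1$. Every $\gamma\in\mathbb F_4$ is written uniquely as $\gamma=b_1\omega+b_2\omega^2$ with $b_1,b_2\in\{0,1\}$ (self-dual basis), which identifies an $\mathbb F_4$-qudit with two qubits, $|\gamma\rangle=|b_1\rangle|b_2\rangle$. The gate $CS$ acts as $CS|\gamma\rangle=i^{b_1b_2}|\gamma\rangle$; put $c(\gamma)=b_1b_2\in\{0,1\}$. The rows of $G$ are $\mathbf g_1,\dots,\mathbf g_m$; the first $k$ are representatives of $X$-logical operators and the remaining $m-k$ are $X$-stabilizer generators of a CSS code. Applying $CS$ to each of the $n$ physical qudits multiplies the basis state $|\sum_a u_a\mathbf g_a\rangle$, $u\in\mathbb F_4^m$, by a phase depending only on $u$. The induced unitary on $m$ qudits (''wires'', one per row) is $$D_G|u\rangle=i^{\sum_{i=1}^n c\left(\sum_{a=1}^m u_a g_{a,i}\right)}|u\rangle,$$ where the inner sum is in $\mathbb F_4$ and the outer sum is over the integers. Clifford unitaries are those normalizing the qubit Pauli group (global phases included). *)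

(* Defs.v *)
From HB Require Import structures.
From mathcomp Require Import all_boot all_order all_algebra.
From mathcomp Require Import reals complex.

Set Implicit Arguments.
Unset Strict Implicit.
Unset Printing Implicit Defensive.

Import Order.TTheory GRing.Theory Num.Theory.
Local Open Scope ring_scope.

Section Operators.
Variable C : numClosedFieldType.

(* Operators on the Hilbert space with orthonormal basis {|x> : x in T} are
   matrices in 'M[C]_#|T|, the basis being numbered by enum_rank/enum_val. *)

(* <x|A|y> *)
Definition entry (T : finType) (A : 'M[C]_#|T|) (x y : T) : C :=
  A (enum_rank x) (enum_rank y).

Definition op_of (T : finType) (f : T -> T -> C) : 'M[C]_#|T| :=
  \matrix_(i, j) f (enum_val i) (enum_val j).

(* |x> |-> f x |x> *)
Definition diag_op (T : finType) (f : T -> C) : 'M[C]_#|T| :=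
  diag_mx (\row_i f (enum_val i)).

(* The tensor product of the A s over all sites s, each site having local
   basis L; basis states of the whole system are functions from sites to L. *)
Definition tensor_op (S L : finType) (A : S -> 'M[C]_#|L|) :
    'M[C]_#|{: {ffun S -> L}}| :=
  op_of (fun x y : {ffun S -> L} => \prod_s entry (A s) (x s) (y s)).

Definition pauliX : 'M[C]_#|{: bool}| := op_of (fun x y => (x != y)%:R).
Definition pauliZ : 'M[C]_#|{: bool}| := diag_op (fun x : bool => (-1) ^+ x).
Definition pauliY : 'M[C]_#|{: bool}| := 'i *: (pauliX *m pauliZ).

(* The Pauli group on the qubits Q: i^t times a tensor product of one-qubit
   Pauli matrices. *)
Definition pauli_group (Q : finType) (A : 'M[C]_#|{: {ffun Q -> bool}}|) : Prop :=
  exists (t : nat) (P : Q -> 'M[C]_#|{: bool}|),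
    (forall q, P q \in [:: 1%:M; pauliX; pauliY; pauliZ])
    /\ A = 'i ^+ t *: tensor_op P.

(* The unitary U satisfies U N U^-1 = N, with N the Pauli group. Every global
   phase is a Clifford unitary in this sense. *)
Definition clifford (Q : finType) (U : 'M[C]_#|{: {ffun Q -> bool}}|) : Prop :=
  U \is unitarymx
  /\ forall A, pauli_group (U *m A *m invmx U) <-> pauli_group A.

(* A (x) I on m sites, for A acting on the first k of them. *)
Definition tensor_id (L : finType) (k m : nat) (le_km : (k <= m)%N)
    (A : 'M[C]_#|{: {ffun 'I_k -> L}}|) : 'M[C]_#|{: {ffun 'I_m -> L}}| :=
  let first (u : {ffun 'I_m -> L}) := [ffun a => u (widen_ord le_km a)] in
  op_of (fun u v : {ffun 'I_m -> L} => entry A (first u) (first v) *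
    [forall a : 'I_m, (k <= a)%N ==> (u a == v a)]%:R).

Section F4.
(* Used with #|F| = 4 and w ^+ 2 = w + 1. *)
Variables (F : finFieldType) (w : F).

Definition of_bits (b : bool * bool) : F := b.1%:R * w + b.2%:R * w ^+ 2.

(* The unique pair of bits (b1, b2) with g = b1 w + b2 w^2. *)
Definition bits (g : F) : bool * bool :=
  odflt (false, false) [pick b | of_bits b == g].

Definition cphase (g : F) : nat := ((bits g).1 * (bits g).2)%N.

Definition CS : 'M[C]_#|F| := diag_op (fun g => 'i ^+ cphase g).

Definition D_G (m n : nat) (G : 'M[F]_(m, n)) : 'M[C]_#|{: {ffun 'I_m -> F}}| :=
  diag_op (fun u : {ffun 'I_m -> F} =>
    'i ^+ (\sum_(i < n) cphase (\sum_(a < m) u a * G a i)%R)%N).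

(* The qubits of m qudits are indexed by 'I_m * 'I_2, and an operator on the
   qudits is read on the qubits through |g> = |b1>|b2>. *)
Definition qudits (m : nat) (x : {ffun 'I_m * 'I_2 -> bool}) :
    {ffun 'I_m -> F} :=
  [ffun a => of_bits (x (a, ord0), x (a, ord_max))].

Definition on_qubits (m : nat) (A : 'M[C]_#|{: {ffun 'I_m -> F}}|) :
    'M[C]_#|{: {ffun 'I_m * 'I_2 -> bool}}| :=
  op_of (fun x y => entry A (qudits x) (qudits y)).

End F4.
End Operators.

Arguments CS : clear implicits.
Arguments CS C {F} w.
Arguments D_G : clear implicits.
Arguments D_G C {F} w {m n} G.

(* Main.v *)
Require Import Defs.
From HB Require Import structures.
From mathcomp Require Import all_boot all_order all_algebra.
From mathcomp Require Import reals complex.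
From mathcomp Require Import finfield ring.

Set Implicit Arguments.
Unset Strict Implicit.
Unset Printing Implicit Defensive.

Import Order.TTheory GRing.Theory Num.Theory.
Local Open Scope ring_scope.

(** A diagonal unitary is Clifford exactly when its third multiplicative
    differences are all 1, i.e. when its phase function is quadratic: then each
    first difference is a power of i times a sign character, hence a Pauli.
    The third difference of i^c(.) on F_4 in the directions r, s, t is
    (-1)^Tr(rst), so that of D_G is (-1)^Tr(sum_abc M_abc r_a s_b t_c) with
    M_abc = sum_i g_ai g_bi g_ci.  Two diagonal unitaries differ by a Clifford
    iff their third differences agree.  Those of V (x) I are 1 as soon as one
    direction vanishes on the first k wires, those of CS^k (x) I come from the
    diagonal tensor, and the tensor M is determined by the signs above because
    the trace form is nondegenerate. *)

(** * Matrix entries and diagonal operators *)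

Section Operators.
Variables (C : numClosedFieldType) (T : finType).
Implicit Types (A B : 'M[C]_#|T|) (f g : T -> C).

Lemma entryP A B : (forall x y, entry A x y = entry B x y) -> A = B.
Proof.
move=> eqAB; apply/matrixP=> i j.
by have := eqAB (enum_val i) (enum_val j); rewrite /entry !enum_valK.
Qed.

Lemma entry_op_of (f : T -> T -> C) x y : entry (op_of f) x y = f x y.
Proof. by rewrite /entry mxE !enum_rankK. Qed.

Lemma entry_diag_op f x y : entry (diag_op f) x y = f x *+ (x == y).
Proof. by rewrite /entry !mxE enum_rankK (inj_eq enum_rank_inj). Qed.

Lemma entry_diag_opMl f A x y : entry (diag_op f *m A) x y = f x * entry A x y.
Proof. by rewrite /entry mul_diag_mx !mxE enum_rankK. Qed.

Lemma entry_diag_opMr f A x y : entry (A *m diag_op f) x y = entry A x y * f y.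
Proof. by rewrite /entry mul_mx_diag !mxE enum_rankK. Qed.

Lemma entry1 x y : entry (1%:M : 'M[C]_#|T|) x y = (x == y)%:R.
Proof. by rewrite /entry mxE (inj_eq enum_rank_inj). Qed.

Lemma entryZ c A x y : entry (c *: A) x y = c * entry A x y.
Proof. by rewrite /entry mxE. Qed.

Lemma diag_op_is_diag f : is_diag_mx (diag_op f).
Proof. exact: diag_mx_is_diag. Qed.

Lemma is_diag_opE A : is_diag_mx A -> A = diag_op (fun x => entry A x x).
Proof.
case/diag_mxP=> d ->; apply: entryP => x y.
by rewrite entry_diag_op /entry !mxE eqxx (inj_eq enum_rank_inj).
Qed.

Lemma diag_opM f g : diag_op f *m diag_op g = diag_op (fun x => f x * g x).
Proof.
by apply: entryP => x y; rewrite entry_diag_opMl !entry_diag_op mulrnAr.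
Qed.

Lemma eq_diag_op f g : f =1 g -> diag_op f = diag_op g.
Proof. by move=> fg; apply: entryP => x y; rewrite !entry_diag_op fg. Qed.

Lemma diag_op_inj f g : diag_op f = diag_op g -> f =1 g.
Proof.
move=> fg x; have := congr1 (fun A => entry A x x) fg.
by rewrite !entry_diag_op eqxx.
Qed.

Lemma diag_op1 f : (forall x, f x = 1) -> diag_op f = 1%:M.
Proof.
by move=> f1; apply: entryP => x y; rewrite entry_diag_op entry1 f1.
Qed.

Lemma diag_op_unitary f : diag_op f \is unitarymx <-> forall x, `|f x| = 1.
Proof.
have -> : (diag_op f \is unitarymx) = (diag_op (fun x => `|f x| ^+ 2) == 1%:M).
  rewrite qualifE; congr (_ == _); apply: entryP => x y.
  rewrite entry_diag_opMl entry_diag_op /entry !mxE enum_rankK.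
  rewrite (inj_eq enum_rank_inj) eq_sym normCK.
  by have [->|_] := eqVneq; rewrite ?mulr0n ?rmorph0 ?mulr0 ?mulr1n.
split=> [/eqP f1 x|f1]; last first.
  by apply/eqP/diag_op1 => x; rewrite f1 expr1n.
have /eqP := congr1 (fun A => entry A x x) f1.
rewrite entry_diag_op entry1 eqxx sqrf_eq1 => /orP[] /eqP // fN1.
by have := normr_ge0 (f x); rewrite fN1 oppr_ge0 ler10.
Qed.

Lemma diag_op_unitmx f : (forall x, f x != 0) -> diag_op f \in unitmx.
Proof.
move=> f0; apply: (proj1 (mulmx1_unit (B := diag_op (fun x => (f x)^-1)) _)).
by rewrite diag_opM; apply: diag_op1 => x; rewrite mulfV.
Qed.

Lemma diag_op_invmx f : (forall x, f x != 0) ->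
  invmx (diag_op f) = diag_op (fun x => (f x)^-1).
Proof.
move=> f0; have fu := diag_op_unitmx f0; apply: (can_inj (mulKmx fu)).
by rewrite mulmxV // diag_opM diag_op1 // => x; rewrite mulfV.
Qed.

End Operators.

(** * Calculus of third multiplicative differences *)

Section CubicPhase.
Variables (C : fieldType) (U : zmodType).
Implicit Types (d e : U -> C) (q p : U -> U -> U -> C).

(* The third multiplicative difference of [d] in the directions [r], [s], [t]
   is [q r s t], whatever the base point [x]. *)
Definition cubic d q := forall x r s t,
  d (x + r + s + t) * d (x + r) * d (x + s) * d (x + t)
  = q r s t * (d x * d (x + r + s) * d (x + r + t) * d (x + s + t)).

Lemma eq_cubic d e q p : d =1 e -> (forall r s t, q r s t = p r s t) ->
  cubic d q -> cubic e p.
Proof. by move=> de qp dq x r s t; have := dq x r s t; rewrite !de qp. Qed.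

Lemma cubicM d e q p : cubic d q -> cubic e p ->
  cubic (fun x => d x * e x) (fun r s t => q r s t * p r s t).
Proof.
move=> dq ep x r s t.
transitivity ((d (x + r + s + t) * d (x + r) * d (x + s) * d (x + t)) *
  (e (x + r + s + t) * e (x + r) * e (x + s) * e (x + t))); first by ring.
by rewrite dq ep; ring.
Qed.

Lemma cubicV d q : cubic d q ->
  cubic (fun x => (d x)^-1) (fun r s t => (q r s t)^-1).
Proof. by move=> dq x r s t; rewrite -!invfM dq. Qed.

Lemma cubic_prod (I : Type) (l : seq I) (P : pred I) (d : I -> U -> C)
    (q : I -> U -> U -> U -> C) :
  (forall i, P i -> cubic (d i) (q i)) ->
  cubic (fun x => \prod_(i <- l | P i) d i x)
        (fun r s t => \prod_(i <- l | P i) q i r s t).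
Proof.
by move=> dq x r s t; rewrite -!big_split; apply: eq_bigr => i /dq; apply.
Qed.

Lemma cubic_inj d q p : (forall x, d x != 0) -> cubic d q -> cubic d p ->
  forall r s t, q r s t = p r s t.
Proof.
move=> d0 dq dp r s t; have := dq 0 r s t; rewrite dp => /mulIf -> //.
by rewrite !mulf_neq0.
Qed.

End CubicPhase.

Lemma cubic_comp (C : fieldType) (U W : zmodType) (h : U -> W) (d : W -> C) q :
  {morph h : x y / x + y} -> cubic d q ->
  cubic (d \o h) (fun r s t => q (h r) (h s) (h t)).
Proof. by move=> hD dq x r s t; rewrite /= !hD. Qed.

Notation quadratic d := (cubic d (fun _ _ _ => 1)).

(** * Pauli operators and diagonal Clifford unitaries *)

Section Pauli.
Variables (C : numClosedFieldType) (Q : finType).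
Implicit Types (s z x y r : {ffun Q -> bool}) (A : 'M[C]_#|{: {ffun Q -> bool}}|).

Lemma addxx x : x + x = 0.
Proof. by apply/ffunP=> q; rewrite !ffunE; case: (x q). Qed.

(** The bits are the exponents of X and Z; when both are set, Y also carries a factor $i$. *)
Definition pauli (s z : bool) : 'M[C]_#|{: bool}| :=
  if s then if z then pauliY C else pauliX C else if z then pauliZ C else 1%:M.

Lemma pauliP (P : 'M[C]_#|{: bool}|) :
  P \in [:: 1%:M; pauliX C; pauliY C; pauliZ C]
  <-> exists s z : bool, P = pauli s z.
Proof.
rewrite !inE; split.
  by case/or4P=> /eqP ->;
    [exists false, false | exists true, false | exists true, true |
     exists false, true].
by case=> [] [] [] [] ->; rewrite eqxx ?orbT.
Qed.

Lemma entry_pauli (s z x y : bool) : entry (pauli s z) x y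
  = 'i ^+ (s && z) * (x == y + s)%:R * (-1) ^+ (z && y).
Proof.
case: s z => [] []; rewrite /pauli /pauliY /pauliX /pauliZ ?entryZ
  ?entry_diag_opMr ?entry_op_of ?entry_diag_op ?entry1; move: x y => [] [];
  by rewrite /= ?(mulr0n, mulr1n, expr0, expr1, mul0r, mulr0, mul1r, mulr1, mulrA).
Qed.

(** The character $(-1)^{z\cdot x}$ of the group of bit strings. *)
Definition sgn z x : C := \prod_q (-1) ^+ (z q && x q).

Lemma sgnDr z x y : sgn z (x + y) = sgn z x * sgn z y.
Proof.
rewrite -big_split; apply: eq_bigr => q _ /=; rewrite ffunE -signr_addb.
by case: (z q) (x q) (y q) => [] [] [].
Qed.

Lemma sgnDl z r x : sgn (z + r) x = sgn z x * sgn r x.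
Proof.
rewrite -big_split; apply: eq_bigr => q _ /=; rewrite ffunE -signr_addb.
by case: (z q) (x q) (r q) => [] [] [].
Qed.

(* The Pauli operator X^s Z^z; addition of bit strings is bitwise xor. *)
Definition weyl s z : 'M[C]_#|{: {ffun Q -> bool}}| :=
  op_of (fun x y : {ffun Q -> bool} => (x == y + s)%:R * sgn z y).

Lemma tensor_pauli s z : tensor_op (fun q => pauli (s q) (z q))
  = 'i ^+ (\sum_q (s q && z q))%N *: weyl s z.
Proof.
apply: entryP => x y; rewrite entryZ !entry_op_of expr_sum /sgn.
rewrite (eq_bigr _ (fun q _ => entry_pauli _ _ _ _)) !big_split /= -mulrA.
congr (_ * (_ * _)); have [->|neq] := eqVneq.
  by rewrite big1 // => q _; rewrite !ffunE eqxx.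
have /existsP[q nq] : [exists q, x q != y q + s q].
  rewrite -negb_forall; apply: contra neq => /forallP eq.
  by apply/eqP/ffunP=> q; rewrite ffunE (eqP (eq q)).
by rewrite (bigD1 q) //= (negPf nq) mul0r.
Qed.

(** Normal form: the factors $i$ hidden in the Y's move into the global phase. *)
Lemma pauli_groupP A :
  pauli_group A <-> exists N s z, A = 'i ^+ N *: weyl s z.
Proof.
split=> [[t [P [inP ->]]]|[N [s [z ->]]]].
  have /fin_all_exists[s /fin_all_exists[z Psz]] q :=
    (pauliP (P q)).1 (inP q).
  exists (t + \sum_q (s q && z q))%N, (finfun s), (finfun z).
  rewrite exprD -scalerA; congr (_ *: _).
  rewrite (_ : (\sum_q _)%N = \sum_q (finfun s q && finfun z q))%N; last first.
    by apply: eq_bigr => q _; rewrite !ffunE.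
  rewrite -tensor_pauli; apply: entryP => x y; rewrite !entry_op_of.
  by apply: eq_bigr => q _; rewrite !ffunE Psz.
(* Each Y brings one factor $i$; three more complete it to $i^4=1$. *)
exists (N + 3 * \sum_q (s q && z q))%N, (fun q => pauli (s q) (z q)).
split=> [q|]; first by apply/pauliP; exists (s q), (z q).
rewrite tensor_pauli scalerA -exprD -addnA -mulSnr exprD exprM.
by rewrite (exprM 'i 2 2) sqrCi sqrrN !expr1n mulr1.
Qed.

Lemma sgn0r z : sgn z 0 = 1.
Proof. by rewrite /sgn big1 // => q _; rewrite ffunE andbF. Qed.

(** A string is the sum of its one-bit strings [e q (x q)], and [B] is $\pm1$ on each of them
    because every string is its own opposite. *)
Lemma sign_character (B : {ffun Q -> bool} -> C) :
  B 0 = 1 -> {morph B : x y / x + y >-> x * y} -> exists z, B =1 sgn z.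
Proof.
move=> B0 BM; pose e q b : {ffun Q -> bool} := [ffun p => (p == q) && b].
exists [ffun q => B (e q true) == -1] => x.
have {1}-> : x = \sum_q e q (x q).
  apply/ffunP=> p; rewrite sum_ffunE (bigD1 p) //= big1 ?ffunE ?eqxx ?addr0 //.
  by move=> q; rewrite ffunE eq_sym => /negPf ->.
rewrite (big_morph _ BM B0); apply: eq_bigr => q _; rewrite ffunE.
case: (x q); last first.
  rewrite andbF (_ : e q false = 0) //.
  by apply/ffunP=> p; rewrite !ffunE andbF.
have /eqP : B (e q true) ^+ 2 = 1 by rewrite expr2 -BM addxx.
rewrite sqrf_eq1 andbT => /orP[] /eqP ->; last by rewrite eqxx.
by have /negPf-> : (1 : C) != -1 by rewrite -addr_eq0 (pnatr_eq0 C 2).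
Qed.

Lemma fourth_root_unity (c : C) : c ^+ 4 = 1 -> exists N, c = 'i ^+ N.
Proof.
move/eqP; rewrite (exprM c 2 2) sqrf_eq1 sqrf_eq1 -sqrCi eqf_sqr.
case/orP=> /orP[] /eqP ->; [exists 0%N | exists 2%N | exists 1%N | exists 3%N].
- by [].
- by rewrite sqrCi.
- by [].
by rewrite exprS sqrCi mulrN1.
Qed.

(** The first difference [g] of a quadratic phase is multiplicative up to the constant [g 0], so
    [g / g 0] is a sign character. It remains to see that [g 0] is a power of $i$. *)
Lemma quadratic_diff (d : {ffun Q -> bool} -> C) s :
  (forall x, d x != 0) -> quadratic d ->
  exists N z, forall x, d (x + s) / d x = 'i ^+ N * sgn z x.
Proof.
move=> d0 dq; pose g x := d (x + s) / d x.
have gq x y : g (x + y) * g 0 = g x * g y.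
  have := dq 0 s x y; rewrite mul1r !add0r => eqd.
  rewrite /g add0r; apply/eqP.
  rewrite !mulf_div eqr_div ?mulf_neq0 // -!mulrA; apply/eqP.
  rewrite [y + s]addrC [x + s]addrC [x + y + s]addrC addrA.
  transitivity (d (s + x + y) * d s * d x * d y); first by ring.
  by rewrite eqd; ring.
have g0 : g 0 != 0 by rewrite mulf_neq0 ?invr_eq0.
have [|x y|z Bz] := @sign_character (fun x => g x / g 0).
- by rewrite mulfV.
- by rewrite mulf_div -gq -[RHS]mulf_div mulfV ?mulr1.
have gz x : g x = g 0 * sgn z x by rewrite -Bz mulrCA mulfV ?mulr1.
suff /fourth_root_unity[N gN] : g 0 ^+ 4 = 1.
  by exists N, z => x; rewrite -gN -gz.
(* Since $s+s=0$, [g s] is the inverse of [g 0]; it is also [g 0 * sgn z s], so [g 0] squares to a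
   sign. *)
have gs : g s * g 0 = 1.
  by rewrite /g add0r addxx mulrC mulf_div [d s * _]mulrC mulfV ?mulf_neq0.
have sgn2 : sgn z s ^+ 2 = 1 by rewrite expr2 -sgnDr addxx sgn0r.
rewrite -[4%N]/(2 * 2)%N exprM -[LHS]mulr1 -sgn2 -exprMn.
by move: gs; rewrite gz mulrAC -expr2 => ->; rewrite expr1n.
Qed.

(** Conjugation multiplies the entry of $X^sZ^z$ at $(y+s,y)$ by $d(y+s)/d(y)$, a power of $i$ times
    a sign character that merges with $Z^z$. *)
Lemma quadratic_conj_pauli (d : {ffun Q -> bool} -> C) A :
  (forall x, d x != 0) -> quadratic d ->
  pauli_group A ->
  pauli_group (diag_op d *m A *m diag_op (fun x => (d x)^-1)).
Proof.
move=> d0 dq /pauli_groupP[N [s [z ->]]].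
have [M [v dv]] := quadratic_diff s d0 dq.
apply/pauli_groupP; exists (N + M)%N, s, (z + v); apply: entryP => x y.
rewrite entry_diag_opMr entry_diag_opMl !entryZ !entry_op_of sgnDl exprD.
have [->|_] := eqVneq; last by rewrite !(mul0r, mulr0).
by rewrite !mul1r mulrAC dv; ring.
Qed.

Lemma diag_clifford (d : {ffun Q -> bool} -> C) :
  (forall x, `|d x| = 1) -> clifford (diag_op d) <-> quadratic d.
Proof.
move=> d1; have d0 x : d x != 0 by rewrite -normr_eq0 d1 oner_neq0.
rewrite /clifford diag_op_invmx //; split=> [[_ cliff] x s r t|dq].
  (* The conjugates of the pure shifts $X^s$ suffice: they show every first difference of [d] to be
     a constant times a character, so the third ones are 1. *)
  have /cliff/pauli_groupP[N [s' [z dz]]] : pauli_group (weyl s 0).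
    by apply/pauli_groupP; exists 0%N, s, 0; rewrite scale1r.
  have ds y : d (y + s) = 'i ^+ N * (s == s')%:R * sgn z y * d y.
    have := congr1 (fun A => entry A (y + s) y) dz.
    rewrite entry_diag_opMr entry_diag_opMl entryZ !entry_op_of eqxx.
    rewrite (inj_eq (addrI y)) /sgn big1 ?mulr1; last first.
      by move=> q _; rewrite ffunE.
    by move/(canRL (divfK (d0 y))); rewrite !mulrA.
  rewrite !(addrAC x s) (addrAC (x + r)) !ds !sgnDr; ring.
split=> [|A]; first exact/diag_op_unitary.
split=> [|/quadratic_conj_pauli]; last exact.
(* The converse implication conjugates back by the inverse phase, which is quadratic too. *)
have d0' x : (d x)^-1 != 0 by rewrite invr_eq0.
have dq' : quadratic (fun x => (d x)^-1).
  by apply: eq_cubic (cubicV dq) => // *; rewrite invr1.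
move/(quadratic_conj_pauli d0' dq'); rewrite !mulmxA diag_opM diag_op1.
  rewrite mul1mx -mulmxA diag_opM diag_op1 ?mulmx1 // => x.
  by rewrite invrK mulVf.
by move=> x; rewrite mulVf.
Qed.

End Pauli.

(** * Tensor products of diagonal operators *)

Section DiagonalLayouts.
Variable C : numClosedFieldType.

Lemma tensor_op_diag (S L : finType) (f : S -> L -> C) :
  tensor_op (fun s => diag_op (f s))
  = diag_op (fun x : {ffun S -> L} => \prod_s f s (x s)).
Proof.
apply: entryP => x y; rewrite entry_op_of entry_diag_op.
have [->|neq] := eqVneq.
  by rewrite mulr1n; apply: eq_bigr => s _; rewrite entry_diag_op eqxx.
have /existsP[s ns] : [exists s, x s != y s].
  rewrite -negb_forall; apply: contra neq => /forallP eq.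
  by apply/eqP/ffunP=> s; rewrite (eqP (eq s)).
by rewrite (bigD1 s) //= entry_diag_op (negPf ns) mul0r.
Qed.

Definition restrict (L : finType) (k m : nat) (le_km : (k <= m)%N)
  (u : {ffun 'I_m -> L}) : {ffun 'I_k -> L} := [ffun a => u (widen_ord le_km a)].

Lemma tensor_id_diag (L : finType) (k m : nat) (le_km : (k <= m)%N)
    (f : {ffun 'I_k -> L} -> C) :
  tensor_id le_km (diag_op f) = diag_op (f \o restrict le_km).
Proof.
apply: entryP => x y; rewrite entry_op_of !entry_diag_op /= -/(restrict le_km x).
have [->|neq] := eqVneq x y.
  rewrite eqxx (_ : [forall a, _] = true) ?mulr1 //.
  by apply/forallP=> a; rewrite eqxx implybT.
have [/ffunP eqf|] := eqVneq (restrict _ _) _; last by rewrite mul0r.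
rewrite (_ : [forall a, _] = false) ?mulr0 //; apply: contraNF neq => /forallP eq.
apply/eqP/ffunP=> a; have [ltak|] := ltnP a k; last first.
  by move=> leka; have := eq a; rewrite leka => /eqP.
have := eqf (Ordinal ltak); rewrite !ffunE.
by rewrite (_ : widen_ord _ _ = a) //; apply: val_inj.
Qed.

End DiagonalLayouts.

(** * Arithmetic, trace and additive character of $\mathbb F_4$ *)

Section F4.
Variables (C : numClosedFieldType) (F : finFieldType) (w : F).
Hypotheses (cardF : #|F| = 4%N) (w2 : w ^+ 2 = w + 1).

Lemma F4_w0 : w != 0.
Proof.
by apply: contra_eq_neq w2 => ->; rewrite expr0n add0r eq_sym oner_neq0.
Qed.

Lemma F4_w4 : w ^+ 4 = w.
Proof. by rewrite -cardF expf_card. Qed.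

Lemma F4_w3 : w ^+ 3 = w ^+ 2 + w.
Proof. by rewrite exprS w2 mulrDr mulr1 -expr2 w2. Qed.

Lemma F4_addxx (x : F) : x + x = 0.
Proof.
suff two : (2%:R : F) = 0 by rewrite -mulr2n -mulr_natr two mulr0.
apply: (mulfI (expf_neq0 2 F4_w0)); rewrite mulr0.
(* Expanding $w^4=(w+1)^2$ turns $w^4-w$ into $2w^2$, which forces characteristic 2. *)
have : w ^+ 4 - w = 0 by rewrite F4_w4 subrr.
by rewrite (exprM w 2 2) w2 sqrrD w2 => <-; ring.
Qed.

Lemma F4_natr_addb (a b : bool) : (a (+) b)%:R = a%:R + b%:R :> F.
Proof. by case: a b => [] []; rewrite ?addr0 ?add0r ?F4_addxx. Qed.

Notation of_bits := (of_bits w).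
Notation bits := (bits w).

Lemma of_bitsD b c : of_bits b + of_bits c = of_bits (b + c).
Proof.
by rewrite /Defs.of_bits /= [in RHS]F4_natr_addb [in RHS]F4_natr_addb; ring.
Qed.

(** Multiplication in the basis $(w,w^2)$, from $w\cdot w^2=w+w^2$ and $w^2\cdot w^2=w$. *)
Definition mul_bits (b c : bool * bool) : bool * bool :=
  ((b.1 && c.2) (+) (b.2 && c.1) (+) (b.2 && c.2),
   (b.1 && c.1) (+) (b.1 && c.2) (+) (b.2 && c.1)).

Lemma of_bitsM b c : of_bits b * of_bits c = of_bits (mul_bits b c).
Proof.
rewrite /Defs.of_bits /= !F4_natr_addb -!mulnb !natrM.
transitivity (b.1%:R * c.1%:R * w ^+ 2 + (b.1%:R * c.2%:R + b.2%:R * c.1%:R) * w ^+ 3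
   + b.2%:R * c.2%:R * w ^+ 4); first by ring.
by rewrite F4_w3 F4_w4; ring.
Qed.

Lemma of_bits_inj : injective of_bits.
Proof.
move=> b c eq; have /eqP : of_bits (b + c) = 0.
  by rewrite -of_bitsD eq F4_addxx.
have ww : w + w ^+ 2 != 0 by rewrite w2 addrA F4_addxx add0r oner_neq0.
case: b c {eq} => [[] []] [[] []]; rewrite /Defs.of_bits /= ?mul1r ?mul0r
  ?addr0 ?add0r ?expf_eq0 ?(negPf F4_w0) ?(negPf ww) //.
Qed.

Lemma of_bitsK : cancel of_bits bits.
Proof.
move=> b; rewrite /Defs.bits; case: pickP => [c /eqP/of_bits_inj //|/(_ b)].
by rewrite eqxx.
Qed.

Lemma bitsK : cancel bits of_bits.
Proof.
have of_bits_bij : bijective of_bits.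
  by apply: inj_card_bij of_bits_inj _; rewrite cardF card_prod card_bool.
exact/(bij_can_sym of_bits_bij)/of_bitsK.
Qed.

(* The absolute trace F_4 -> F_2: both w and w ^+ 2 have trace 1. *)
Definition F4_trace (g : F) : bool := (bits g).1 (+) (bits g).2.

Definition chi (g : F) : C := (-1) ^+ F4_trace g.

Lemma chiD g h : chi (g + h) = chi g * chi h.
Proof.
rewrite /chi /F4_trace -signr_addb -[g in g + h]bitsK -[h in _ + h]bitsK.
rewrite of_bitsD !of_bitsK; congr (_ ^+ nat_of_bool _).
by case: (bits g) (bits h) => [[] []] [[] []].
Qed.

Lemma bits0 : bits 0 = (false, false).
Proof. by rewrite -[0 in LHS](F4_addxx (of_bits 0)) of_bitsD of_bitsK. Qed.

Lemma chi0 : chi 0 = 1.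
Proof. by rewrite /chi /F4_trace bits0. Qed.

Lemma chi_sum (I : Type) (l : seq I) (P : pred I) (g : I -> F) :
  chi (\sum_(i <- l | P i) g i) = \prod_(i <- l | P i) chi (g i).
Proof. exact: (big_morph _ chiD chi0). Qed.

(** Nondegeneracy of the trace form: a nonzero [g] can be scaled to $w$, whose trace is 1. *)
Lemma chi_eq1 g : (forall l, chi (l * g) = 1) -> g = 0.
Proof.
move=> chi1; apply: contraTeq isT => g0.
have := chi1 (w / g); rewrite divfK // /chi /F4_trace.
rewrite (_ : bits w = (true, false)) => [/eqP|].
  by rewrite eq_sym -addr_eq0 (pnatr_eq0 C 2).
by apply: of_bits_inj; rewrite bitsK /Defs.of_bits /= mul1r mul0r addr0.
Qed.

Lemma chi_inj g h : (forall l, chi (l * g) = chi (l * h)) -> g = h.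
Proof.
move=> eq; apply/eqP; rewrite -subr_eq0; apply/eqP/chi_eq1 => l.
rewrite mulrBr -(addr0 (- _)) -(F4_addxx (l * h)) addKr chiD eq -chiD.
by rewrite F4_addxx chi0.
Qed.

(** With $-1=i^2$ both sides are powers of $i$; their exponents are compared modulo 4 for all 256
    values of the eight bits. *)
Lemma cubic_cphase :
  cubic (fun g => 'i ^+ cphase w g : C) (fun r s t => chi (r * s * t)).
Proof.
have i4 : 'i ^+ 4 = 1 :> C by rewrite (exprM 'i 2 2) sqrCi sqrrN expr1n.
have i2 : -1 = 'i ^+ 2 :> C by rewrite sqrCi.
move=> x r s t; rewrite /chi i2 -exprM -!exprD -(expr_mod _ i4) -[RHS](expr_mod _ i4).
congr (_ ^+ _).
rewrite -(bitsK x) -(bitsK r) -(bitsK s) -(bitsK t) !(of_bitsD, of_bitsM).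
rewrite /cphase /F4_trace !of_bitsK.
by move: (bits x) (bits r) (bits s) (bits t) =>
  [[] []] [[] []] [[] []] [[] []].
Qed.

(** * Qudits as pairs of qubits, and trilinear forms on the wires *)

Section Wires.
Variable m : nat.
Implicit Types (u r s t : {ffun 'I_m -> F}) (M N : 'I_m -> 'I_m -> 'I_m -> F).

Lemma quditsD : {morph qudits w (m := m) : x y / x + y}.
Proof. by move=> x y; apply/ffunP=> a; rewrite !ffunE of_bitsD. Qed.

Definition qubits u : {ffun 'I_m * 'I_2 -> bool} :=
  [ffun p => if p.2 == ord0 then (bits (u p.1)).1 else (bits (u p.1)).2].

Lemma qubitsK : cancel qubits (qudits w (m := m)).
Proof. by move=> u; apply/ffunP=> a; rewrite !ffunE /= -surjective_pairing bitsK. Qed.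

Lemma quditsK : cancel (qudits w (m := m)) qubits.
Proof.
move=> x; apply/ffunP=> -[a j]; rewrite !ffunE of_bitsK /=.
by case: eqP => [->//|]; case: j => [] [|[|]] // p np;
  [case: np|congr (x (_, _))]; apply: val_inj.
Qed.

Lemma qubitsD : {morph qubits : u r / u + r}.
Proof.
by move=> u r; apply: (can_inj quditsK); rewrite quditsD !qubitsK.
Qed.

Lemma on_qubits_diag (f : {ffun 'I_m -> F} -> C) :
  on_qubits w (diag_op f) = diag_op (f \o qudits w (m := m)).
Proof.
apply: entryP => x y.
by rewrite entry_op_of !entry_diag_op (inj_eq (can_inj quditsK)).
Qed.

(** The equation forces the diagonal of [K] to be $f/g$ read on bits. Passing between bits and
    qudits is additive, so it preserves being quadratic, which for [K] means being Clifford. *)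
Lemma clifford_factor (f g : {ffun 'I_m -> F} -> C) :
  (forall u, `|f u| = 1) -> (forall u, `|g u| = 1) ->
  (exists K : 'M[C]_#|{: {ffun 'I_m * 'I_2 -> bool}}|,
    [/\ is_diag_mx K, clifford K
      & on_qubits w (diag_op f) = K *m on_qubits w (diag_op g)])
  <-> quadratic (fun u => f u / g u).
Proof.
move=> f1 g1; pose d u := f u / g u.
have d1 u : `|d u| = 1 by rewrite normrM normfV f1 g1 divr1.
have g0 u : g u != 0 by rewrite -normr_eq0 g1 oner_neq0.
rewrite !on_qubits_diag; split=> [[K [/is_diag_opE -> cliffK]]|dq].
  move: cliffK; set e := fun x => entry K x x => cliffe.
  rewrite diag_opM => /diag_op_inj eqf.
  have {}eqf u : f u / g u = e (qubits u).
    by have := eqf (qubits u); rewrite /= qubitsK => ->; rewrite mulfK.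
  have eq : quadratic e.
    apply/diag_clifford => // x.
    by rewrite -(quditsK x) -eqf d1.
  by apply: eq_cubic (cubic_comp qubitsD eq) => // u; rewrite -eqf.
exists (diag_op (d \o qudits w (m := m))); split.
- exact: diag_op_is_diag.
- by apply/diag_clifford => [x|]; [apply: d1|apply: (cubic_comp quditsD dq)].
- by rewrite diag_opM; apply: eq_diag_op => x; rewrite /= divfK.
Qed.

Definition trilinear M r s t : F :=
  \sum_a r a * \sum_b s b * \sum_c t c * M a b c.

Definition single (a : 'I_m) (l : F) : {ffun 'I_m -> F} :=
  [ffun b => if b == a then l else 0].

Lemma sum_single a l (f : 'I_m -> F) : \sum_b single a l b * f b = l * f a.
Proof.
rewrite (bigD1 a) //= big1 ?ffunE ?eqxx ?addr0 // => b /negPf nb.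
by rewrite ffunE nb mul0r.
Qed.

Lemma trilinear_single M a b c l :
  trilinear M (single a 1) (single b 1) (single c l) = l * M a b c.
Proof.
by rewrite /trilinear !sum_single !mul1r.
Qed.

(** Directions supported on single wires isolate one coefficient, and the free scalar [l] on the
    third lets nondegeneracy of the trace recover it from signs. *)
Lemma chi_trilinear_inj M N :
  (forall r s t, chi (trilinear M r s t) = chi (trilinear N r s t)) ->
  forall a b c, M a b c = N a b c.
Proof.
by move=> eq a b c; apply: chi_inj => l; rewrite -!trilinear_single eq.
Qed.

Lemma eq_trilinear M N r s t : (forall a b c, M a b c = N a b c) ->
  trilinear M r s t = trilinear N r s t.
Proof.
move=> eq; apply: eq_bigr => a _; congr (_ * _); apply: eq_bigr => b _.
by congr (_ * _); apply: eq_bigr => c _; rewrite eq.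
Qed.

Definition moment n (G : 'M[F]_(m, n)) (a b c : 'I_m) : F :=
  \sum_(i < n) G a i * G b i * G c i.

(** Cyclic shifts are enough to bring any chosen index into last place. *)
Lemma momentC n (G : 'M[F]_(m, n)) a b c : moment G a b c = moment G b c a.
Proof. by apply: eq_bigr => i _; rewrite [RHS]mulrC mulrA. Qed.

Lemma trilinear_moment n (G : 'M[F]_(m, n)) r s t :
  trilinear (moment G) r s t
  = \sum_(i < n) (\sum_a r a * G a i) * (\sum_a s a * G a i)
      * (\sum_a t a * G a i).
Proof.
under [RHS]eq_bigr do rewrite -mulrA mulr_suml.
rewrite exchange_big; apply: eq_bigr => a _ /=.
under [RHS]eq_bigr do rewrite mulr_suml mulr_sumr.
rewrite exchange_big mulr_sumr; apply: eq_bigr => b _ /=.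
under [RHS]eq_bigr do rewrite !mulr_sumr.
rewrite exchange_big !mulr_sumr; apply: eq_bigr => c _ /=.
by rewrite !mulr_sumr; apply: eq_bigr => i _; ring.
Qed.

(** The diagonal of [D_G], kept convertible with it. *)
Definition phaseG n (G : 'M[F]_(m, n)) u : C :=
  'i ^+ (\sum_(i < n) cphase w (\sum_(a < m) u a * G a i)%R)%N.

(** Each physical position contributes $i^c$ composed with an additive map of [u]; the characters
    $\chi(rst)$ multiply into one of the sum over positions. *)
Lemma cubic_phaseG n (G : 'M[F]_(m, n)) :
  cubic (phaseG G) (fun r s t => chi (trilinear (moment G) r s t)).
Proof.
pose ev i u := \sum_a u a * G a i.
have evD i : {morph ev i : u r / u + r}.
  by move=> u r; rewrite -big_split; apply: eq_bigr => a _ /=; rewrite ffunE mulrDl.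
apply: eq_cubic (cubic_prod (index_enum 'I_n) (P := xpredT)
  (fun i _ => cubic_comp (evD i) cubic_cphase)) => [u|r s t].
  by rewrite /phaseG expr_sum.
by rewrite trilinear_moment chi_sum.
Qed.

Lemma normi (N : nat) : `|'i ^+ N : C| = 1.
Proof. by rewrite normrX normCi expr1n. Qed.

(** * Operators on the first $k$ wires *)

Section FirstWires.
Variables (k : nat) (le_km : (k <= m)%N).

(** Padding by 0 on the remaining wires; it serves to define a candidate for $V$. *)
Definition extend (v : {ffun 'I_k -> F}) : {ffun 'I_m -> F} :=
  [ffun a : 'I_m => oapp v 0 (insub (a : nat))].

Definition proj u : {ffun 'I_m -> F} := [ffun a : 'I_m => u a *+ (a < k)%N].

Lemma extend_restrict u : extend (restrict le_km u) = proj u.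
Proof.
apply/ffunP=> a; rewrite !ffunE; case: insubP => [b ak vb|/negPf ->] //=.
by rewrite ffunE ak (_ : widen_ord _ _ = a) //; apply: val_inj.
Qed.

Lemma restrictD : {morph @restrict F k m le_km : u r / u + r}.
Proof. by move=> u r; apply/ffunP=> a; rewrite !ffunE. Qed.

Lemma projD : {morph proj : u r / u + r}.
Proof. by move=> u r; apply/ffunP=> a; rewrite !ffunE mulrnDl. Qed.

Lemma trilinear_proj M r s t :
  (forall a b c : 'I_m, ~~ [&& (a < k)%N, (b < k)%N & (c < k)%N] -> M a b c = 0) ->
  trilinear M (proj r) (proj s) (proj t) = trilinear M r s t.
Proof.
move=> M0; rewrite /trilinear; apply: eq_bigr => a _; rewrite !mulr_sumr.
apply: eq_bigr => b _; rewrite !mulr_sumr; apply: eq_bigr => c _.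
have [/and3P[ak bk ck]|/M0->] := boolP [&& (a < k)%N, (b < k)%N & (c < k)%N].
  by rewrite !ffunE ak bk ck.
by rewrite !mulr0.
Qed.

(** The direction [t] is invisible to [v], so the same four values of [v] occur on both sides of the
    difference identity and only the quadratic factor [d] is left. *)
Lemma cubic_restrict_eq1 (d : {ffun 'I_m -> F} -> C) (v : {ffun 'I_k -> F} -> C)
    q r s t :
  (forall u, d u * v (restrict le_km u) != 0) ->
  quadratic d -> cubic (fun u => d u * v (restrict le_km u)) q ->
  restrict le_km t = 0 -> q r s t = 1.
Proof.
move=> f0 dq fq t0; have := fq 0 r s t; have := dq 0 r s t.
rewrite !restrictD t0 !addr0 => dE fE.
have X0 := mulf_neq0 (mulf_neq0 (mulf_neq0 (f0 0) (f0 (0 + r + s))) (f0 (0 + r + t)))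
  (f0 (0 + s + t)).
rewrite !restrictD t0 !addr0 in X0; apply: (mulIf X0); rewrite -fE mul1r.
set v0 := v _; set v1 := v _; set v2 := v _; set v3 := v _.
transitivity (d (0 + r + s + t) * d (0 + r) * d (0 + s) * d (0 + t) *
  (v0 * v1 * v2 * v3)); first by ring.
by rewrite dE; ring.
Qed.

(** The tensor of $CS^{\otimes k}\otimes I$, prescribed in the second equivalence. *)
Definition diagonal3 (a b c : 'I_m) : F :=
  if [&& a == b, b == c & (c < k)%N] then 1 else 0.

Lemma trilinear_diagonal3 r s t : trilinear diagonal3 r s t
  = \sum_(a < k) restrict le_km r a * restrict le_km s a * restrict le_km t a.
Proof.
transitivity (\sum_(a < m | (a < k)%N) r a * s a * t a).
  rewrite big_mkcond; apply: eq_bigr => a _.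
  have sum_at (h : 'I_m -> F) : (forall b, b != a -> h b = 0) -> \sum_b h b = h a.
    by move=> h0; rewrite (bigD1 a) //= big1 ?addr0.
  rewrite sum_at => [|b nb]; last first.
    rewrite big1 ?mulr0 // => c _.
    by rewrite /diagonal3 eq_sym (negPf nb) mulr0.
  rewrite sum_at => [|c nc]; last first.
    by rewrite /diagonal3 eqxx eq_sym (negPf nc) mulr0.
  by rewrite /diagonal3 !eqxx /=; case: ifP => _; rewrite ?mulr0 // mulr1 mulrA.
rewrite (big_ord_narrow le_km); apply: eq_bigr => a _.
by rewrite !ffunE.
Qed.

Definition phaseCS (v : {ffun 'I_k -> F}) : C := \prod_a 'i ^+ cphase w (v a).

Lemma cubic_phaseCS : cubic (phaseCS \o restrict le_km)
  (fun r s t => chi (trilinear diagonal3 r s t)).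
Proof.
pose ev a u := restrict le_km u a.
have evD a : {morph ev a : u r / u + r}.
  by move=> u r; rewrite /ev restrictD ffunE.
apply: eq_cubic (cubic_prod (index_enum 'I_k) (P := xpredT)
  (fun a _ => cubic_comp (evD a) cubic_cphase)) => [//|r s t].
by rewrite trilinear_diagonal3 chi_sum.
Qed.

End FirstWires.
End Wires.
End F4.

(** * The two equivalences for [D_G] *)

Local Open Scope complex_scope.

Theorem mainTheorem1 (R : realType) (F : finFieldType) (w : F)
    (cardF : #|F| = 4%N) (w2 : w ^+ 2 = w + 1)
    (m n k : nat) (k_ge1 : (1 <= k)%N) (le_km : (k <= m)%N)
    (G : 'M[F]_(m, n)) (full_rank : \rank G = minn m n) :
  ((exists (K : 'M[R[i]]_#|{: {ffun 'I_m * 'I_2 -> bool}}|)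
           (V : 'M[R[i]]_#|{: {ffun 'I_k -> F}}|),
      [/\ is_diag_mx K, clifford K, is_diag_mx V, V \is unitarymx
        & on_qubits w (D_G R[i] w G) = K *m on_qubits w (tensor_id le_km V)])
   <->
   (forall a b c : 'I_m, ~~ [&& (a < k)%N, (b < k)%N & (c < k)%N] ->
      \sum_(i < n) G a i * G b i * G c i = 0))
  /\
  ((exists K : 'M[R[i]]_#|{: {ffun 'I_m * 'I_2 -> bool}}|,
      [/\ is_diag_mx K, clifford K
        & on_qubits w (D_G R[i] w G)
          = K *m on_qubits w (tensor_id le_km
                   (tensor_op (fun _ : 'I_k => CS R[i] w)))])
   <->
   (forall a b c : 'I_m,
      \sum_(i < n) G a i * G b i * G c i
      = if [&& a == b, b == c & (c < k)%N] then 1 else 0)).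
Proof.
pose f := phaseG R[i] w G.
have f1 u : `|f u| = 1 by apply: normi.
have fq : cubic f _ := cubic_phaseG R[i] cardF w2 G.
have f0 u : f u != 0 by rewrite -normr_eq0 f1 oner_neq0.
split; split.
- case=> K [V [diagK cliffK /is_diag_opE VE]].
  move: VE; set v := (fun x => entry V x x) => ->.
  rewrite tensor_id_diag => /diag_op_unitary v1 eqD.
  have g1 u : `|(v \o restrict le_km) u| = 1 by apply: v1.
  have g0 u : v (restrict le_km u) != 0 by rewrite -normr_eq0 v1 oner_neq0.
  have /(clifford_factor cardF w2 f1 g1) dq : exists K, [/\ is_diag_mx K, clifford K
    & on_qubits w (diag_op f) = K *m on_qubits w (diag_op (v \o restrict le_km))].
    by exists K.
  have last0 (a b c : 'I_m) : (k <= c)%N -> moment G a b c = 0.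
    move=> kc; apply: (@chi_eq1 R[i] _ w cardF w2) => l; rewrite -trilinear_single.
    (* Writing $f=(f/v)\,v$ exposes the quadratic factor; the third direction, supported on wire
       $c\ge k$, restricts to 0. *)
    have fq' := eq_cubic (e := fun u => f u / v (restrict le_km u) * v (restrict le_km u))
      (fun u => esym (divfK (g0 u) (f u))) (fun _ _ _ => erefl) fq.
    apply: (cubic_restrict_eq1 _ _ _ dq fq') => [u|]; first by rewrite /= divfK.
    apply/ffunP=> d; rewrite !ffunE; case: eqP => // eqc.
    by move: kc; rewrite -eqc leqNgt /= ltn_ord.
  move=> a b c; rewrite -/(moment G a b c) !negb_and -!leqNgt.
  case/or3P=> le; last exact: last0.
    by rewrite momentC last0.
  by rewrite 2!momentC last0.
(* $V$ is $D_G$ on inputs padded by zeros. As the moments vanish off the first $k$ wires, projecting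
   the directions leaves the trilinear form unchanged, so the quotient is quadratic. *)
- move=> M0; pose v := f \o @extend F m k.
  have vE u : v (restrict le_km u) = f (proj k u) by rewrite /v /= extend_restrict.
  have [||K [diagK cliffK eqD]] :=
    (clifford_factor cardF w2 (f := f) (g := v \o restrict le_km) f1 _).2.
  + by move=> u; apply: f1.
  + have gq := cubicV (cubic_comp (@projD F m k) fq).
    apply: eq_cubic (cubicM fq gq) => [u|r s t] /=; first by rewrite vE.
    by rewrite trilinear_proj // mulfV // signr_eq0.
  exists K, (diag_op v); split=> //; first exact: diag_op_is_diag.
    by apply/diag_op_unitary => u; apply: f1.
  by rewrite tensor_id_diag.
- rewrite /CS tensor_op_diag tensor_id_diag.
  have g1 u : `|(@phaseCS R[i] F w k \o restrict le_km) u| = 1.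
    by rewrite /= normr_prod big1 // => a _; apply: normi.
  move/(clifford_factor cardF w2 f1 g1) => dq.
  (* Multiplying the quadratic quotient back by the $CS$ phase gives a second expression for the
     third difference of [f], to be matched with the one from the moments. *)
  have gq := cubicM dq (cubic_phaseCS R[i] cardF w2 le_km).
  apply: (chi_trilinear_inj (C := R[i]) cardF w2 (N := diagonal3 F k)).
  apply: (cubic_inj f0 fq); apply: eq_cubic gq => [u|r s t]; last exact: mul1r.
  by rewrite divfK // -normr_eq0 g1 oner_neq0.
- move=> M1; rewrite /CS tensor_op_diag tensor_id_diag.
  apply/(clifford_factor cardF w2 f1) => [u|].
    by rewrite /= normr_prod big1 // => a _; apply: normi.
  (* Both phases have the same third differences, so those of their quotient are 1. *)
  apply: eq_cubic (cubicM fq (cubicV (cubic_phaseCS R[i] cardF w2 le_km))) => //.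
  move=> r s t; rewrite (eq_trilinear (N := diagonal3 F k)) // mulfV //.
  by rewrite signr_eq0.
Qed.
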